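(* Let $H$ be a pointed Hopf algebra over a field $\mathbb{K}$ with invertible antipode and finite group $G=G(H)$ of grouplike elements, and let $A=A_{par}$. Given $X\in\mathcal{P}_1(G)$ and $g\in G$ such that $g^{-1}\in X$: (1) $AP_{G_X}\simeq AP_{gG_Xg^{-1}}=AP_{G_{gX}}$ as algebras; (2) $AP_X\simeq AP_{gX}$ as algebras.
   Context: Sweedler notation $\Delta(h)=h_{1}\otimes h_{2}$ is used; $S$ is the antipode of $H$. A Hopf algebra is pointed if all its simple subcoalgebras are one-dimensional. The algebra $H_{par}$ is the quotient of the tensor algebra $T(H)$ by the relations $1_H=1_{T(H)}$, $h\otimes k_{1}\otimes S(k_{2})=hk_{1}\otimes S(k_{2})$ and $h_{1}\otimes S(h_{2})\otimes k=h_{1}\otimes S(h_{2})k$ for all $h,k\in H$; $[h]$ is the class of $h\in H$, and $\varepsilon_h=[h_1][S(h_2)]$. $A_{par}$ is the subalgebra of $H_{par}$ generated by all $\varepsilon_h$, $h\in H$. $\mathcal{P}_1(G)=\{X\subseteq G\mid 1_H\in X\}$ and, for $X\in\mathcal{P}_1(G)$, $P_X=\prod_{x\in X}\varepsilon_x\prod_{y\in G\setminus X}(1_A-\varepsilon_y)$, a central idempotent of $A$, so $AP_X$ is an algebra with unit $P_X$. For $X\in\mathcal{P}_1(G)$, $G_X=\{t\in G\mid tX=X\}$, a subgroup of $G$. *)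

(* Defs.v *)
From HB Require Import structures.
From mathcomp Require Import all_boot all_order all_algebra finmap.
From mathcomp.multinomials Require Import monalg.
From mathcomp Require Import boolp classical_sets functions.

Set Implicit Arguments.
Unset Strict Implicit.
Unset Printing Implicit Defensive.

Import GRing.Theory.

Local Open Scope fset_scope.
Local Open Scope classical_set_scope.
Local Open Scope quotient_scope.
Local Open Scope ring_scope.

Section Span.
Context (K : fieldType) (V : lmodType K) (S : set V).

Inductive span : V -> Prop :=
| span_nil : span 0
| span_cons a x y of S x & span y : span (a *: x + y).

Lemma spanD x y : span x -> span y -> span (x + y).
Proof.
move=> sx sy; elim: sx => [|a u v Su _ IH]; first by rewrite add0r.
by rewrite -addrA; apply: span_cons.
Qed.

Lemma spanZ a x : span x -> span (a *: x).
Proof.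
elim=> [|b u v Su _ IH]; first by rewrite scaler0; apply: span_nil.
by rewrite scalerDr scalerA; apply: span_cons.
Qed.

Lemma span_gen x : S x -> span x.
Proof.
by move=> Sx; rewrite -[x]addr0 -[x]scale1r; apply: span_cons => //; apply: span_nil.
Qed.

Lemma span_kill (U : lmodType K) (f : V -> U) :
  linear f -> (forall x, S x -> f x = 0) -> forall x, span x -> f x = 0.
Proof.
move=> fl fS x; elim=> [|a u v Su _ IH]; last by rewrite fl fS // IH scaler0 addr0.
by have := fl (-1) 0 0; rewrite scaler0 addr0 scaleN1r addNr.
Qed.

Definition in_span : pred V := fun x => `[< span x >].

Lemma in_spanP x : reflect (span x) (x \in in_span).
Proof. exact: asboolP. Qed.

Lemma in_span_zmod_closed : zmod_closed in_span.
Proof.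
split=> [|x y /in_spanP sx /in_spanP sy]; apply/in_spanP; first exact: span_nil.
by rewrite -scaleN1r; apply: spanD => //; apply: spanZ.
Qed.

HB.instance Definition _ := GRing.isZmodClosed.Build V in_span in_span_zmod_closed.

Definition span_closed : zmodClosed V := GRing.ZmodClosed.clone V in_span _.

End Span.

Section ModuleQuotient.
Context (K : fieldType) (V : lmodType K) (S : set V).

(* V / span S *)
Definition mquot : Type := Quotient.quot (span_closed S).

HB.instance Definition _ := GRing.Zmodule.on mquot.

Definition mquot_pi (x : V) : mquot := \pi_(Quotient.quot (span_closed S)) x.
Definition mquot_repr (q : mquot) : V :=
  repr (q : Quotient.quot (span_closed S)).

Lemma mquot_reprK : cancel mquot_repr mquot_pi.
Proof. exact: reprK. Qed.

Lemma mquot_piE x y : mquot_pi x = mquot_pi y <-> span S (x - y).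
Proof.
split=> [/eqP|/in_spanP]; rewrite /mquot_pi.
  by rewrite -(Quotient.idealrBE (span_closed S)) => /in_spanP.
by rewrite (Quotient.idealrBE (span_closed S)) => /eqP.
Qed.

Lemma mquot_piB : zmod_morphism mquot_pi.
Proof. by move=> x y; rewrite /mquot_pi raddfB. Qed.

HB.instance Definition _ := GRing.isZmodMorphism.Build V mquot mquot_pi mquot_piB.

Definition mquot_scale (a : K) (q : mquot) : mquot := mquot_pi (a *: mquot_repr q).

Lemma mquot_pi_scale a x : mquot_scale a (mquot_pi x) = mquot_pi (a *: x).
Proof.
apply/mquot_piE; rewrite -scalerBr; apply: spanZ.
by apply/mquot_piE; rewrite mquot_reprK.
Qed.

Lemma mquot_scaleA a b q :
  mquot_scale a (mquot_scale b q) = mquot_scale (a * b) q.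
Proof. by rewrite -[q]mquot_reprK !mquot_pi_scale scalerA. Qed.

Lemma mquot_scale1 : left_id 1 mquot_scale.
Proof. by move=> q; rewrite -[q]mquot_reprK mquot_pi_scale scale1r. Qed.

Lemma mquot_scaleDr : right_distributive mquot_scale +%R.
Proof.
move=> a p q; rewrite -[p]mquot_reprK -[q]mquot_reprK -raddfD !mquot_pi_scale.
by rewrite scalerDr raddfD.
Qed.

Lemma mquot_scaleDl q : {morph mquot_scale^~ q : a b / a + b}.
Proof.
by move=> a b; rewrite -[q]mquot_reprK !mquot_pi_scale scalerDl raddfD.
Qed.

HB.instance Definition _ := GRing.Zmodule_isLmodule.Build K mquot
  mquot_scaleA mquot_scale1 mquot_scaleDr mquot_scaleDl.

Lemma mquot_piZ : scalable mquot_pi.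
Proof. by move=> a x; rewrite -mquot_pi_scale. Qed.

HB.instance Definition _ := GRing.isScalable.Build K V mquot *:%R mquot_pi mquot_piZ.

Lemma mquot_pi_gen x : S x -> mquot_pi x = 0.
Proof.
move=> Sx; rewrite -[RHS](raddf0 mquot_pi); apply/mquot_piE; rewrite subr0.
exact: span_gen.
Qed.

Lemma mquot_ind (P : mquot -> Prop) : (forall x, P (mquot_pi x)) -> forall q, P q.
Proof. by move=> Ppi q; rewrite -[q]mquot_reprK. Qed.

End ModuleQuotient.

Section AlgebraQuotient.
Context (K : fieldType) (B : algType K) (S : set B).

Definition ideal_gens : set B :=
  [set x | exists a b u, S u /\ x = a * u * b].

(* the quotient of B by the two-sided ideal generated by S *)
Definition aquot : Type := mquot ideal_gens.

HB.instance Definition _ := GRing.Lmodule.on aquot.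

Definition aquot_pi : B -> aquot := @mquot_pi K B ideal_gens.
Definition aquot_repr : aquot -> B := @mquot_repr K B ideal_gens.

HB.instance Definition _ := GRing.Linear.on aquot_pi.

Lemma aquot_reprK : cancel aquot_repr aquot_pi.
Proof. exact: mquot_reprK. Qed.

Lemma ideal_mull a x : span ideal_gens x -> span ideal_gens (a * x).
Proof.
elim=> [|c u v [l [r [w [Sw ->]]]] _ IH]; first by rewrite mulr0; apply: span_nil.
rewrite mulrDr -scalerAr; apply: span_cons => //.
by exists (a * l), r, w; rewrite !mulrA.
Qed.

Lemma ideal_mulr a x : span ideal_gens x -> span ideal_gens (x * a).
Proof.
elim=> [|c u v [l [r [w [Sw ->]]]] _ IH]; first by rewrite mul0r; apply: span_nil.
rewrite mulrDl -scalerAl; apply: span_cons => //.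
by exists l, (r * a), w; rewrite !mulrA.
Qed.

Definition aquot_one : aquot := aquot_pi 1.
(* [locked], here and below, only prevents unification from unfolding *)
Definition aquot_mul : aquot -> aquot -> aquot :=
  locked (fun p q => aquot_pi (aquot_repr p * aquot_repr q)).

Lemma aquot_pi_mul x y : aquot_mul (aquot_pi x) (aquot_pi y) = aquot_pi (x * y).
Proof.
rewrite /aquot_mul -lock; apply/mquot_piE.
set x' := aquot_repr _; set y' := aquot_repr _.
have -> : x' * y' - x * y = (x' - x) * y' + x * (y' - y).
  by rewrite mulrBl mulrBr addrA subrK.
apply: spanD; [apply: ideal_mulr | apply: ideal_mull];
  by apply/mquot_piE; rewrite mquot_reprK.
Qed.

Lemma aquot_mulA : associative aquot_mul.
Proof.
move=> p q r; rewrite -[p]aquot_reprK -[q]aquot_reprK -[r]aquot_reprK.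
by rewrite !aquot_pi_mul mulrA.
Qed.

Lemma aquot_mul1l : left_id aquot_one aquot_mul.
Proof. by move=> p; rewrite -[p]aquot_reprK aquot_pi_mul mul1r. Qed.

Lemma aquot_mul1r : right_id aquot_one aquot_mul.
Proof. by move=> p; rewrite -[p]aquot_reprK aquot_pi_mul mulr1. Qed.

Lemma aquot_mulDl : left_distributive aquot_mul +%R.
Proof.
move=> p q r; rewrite -[p]aquot_reprK -[q]aquot_reprK -[r]aquot_reprK.
by rewrite -raddfD !aquot_pi_mul mulrDl raddfD.
Qed.

Lemma aquot_mulDr : right_distributive aquot_mul +%R.
Proof.
move=> p q r; rewrite -[p]aquot_reprK -[q]aquot_reprK -[r]aquot_reprK.
by rewrite -raddfD !aquot_pi_mul mulrDr raddfD.
Qed.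

HB.instance Definition _ := GRing.Zmodule_isPzRing.Build aquot
  aquot_mulA aquot_mul1l aquot_mul1r aquot_mulDl aquot_mulDr.

Lemma aquot_pi_monoid : monoid_morphism aquot_pi.
Proof. by split=> // x y; rewrite -aquot_pi_mul. Qed.

HB.instance Definition _ := GRing.isMonoidMorphism.Build B aquot aquot_pi
  aquot_pi_monoid.

Lemma aquot_piZ a x : aquot_pi (a *: x) = a *: aquot_pi x.
Proof. exact: mquot_piZ. Qed.

Lemma aquot_piM x y : aquot_pi (x * y) = aquot_pi x * aquot_pi y.
Proof. by rewrite -aquot_pi_mul. Qed.

Lemma aquot_scaleAl (a : K) (p q : aquot) : a *: (p * q) = (a *: p) * q.
Proof.
rewrite -[p]aquot_reprK -[q]aquot_reprK.
by rewrite -aquot_piM -!aquot_piZ -aquot_piM -scalerAl.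
Qed.

Lemma aquot_scaleAr (a : K) (p q : aquot) : a *: (p * q) = p * (a *: q).
Proof.
rewrite -[p]aquot_reprK -[q]aquot_reprK.
by rewrite -aquot_piM -!aquot_piZ -aquot_piM -scalerAr.
Qed.

Lemma aquot_pi_gen x : S x -> aquot_pi x = 0.
Proof.
by move=> Sx; apply: mquot_pi_gen; exists 1, 1, x; rewrite mul1r mulr1.
Qed.

Definition aquot_lift (C : algType K) (f : B -> C) (q : aquot) : C := f (aquot_repr q).

Lemma aquot_liftE (C : algType K) (f : {lrmorphism B -> C}) :
  (forall x, S x -> f x = 0) -> forall x, aquot_lift f (aquot_pi x) = f x.
Proof.
move=> fS x; apply/eqP; rewrite /aquot_lift -subr_eq0 -rmorphB; apply/eqP.
apply: (@span_kill _ _ ideal_gens) => [||].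
- exact: linearP.
- move=> _ [a [b [u [Su ->]]]].
  have e : f (a * u * b) = f a * f u * f b by rewrite !rmorphM.
  by apply: (etrans e); rewrite (fS u Su) mulr0 mul0r.
- by apply/mquot_piE; rewrite mquot_reprK.
Qed.

Lemma aquot_nontrivial (C : algType K) (f : {lrmorphism B -> C}) :
  (forall x, S x -> f x = 0) -> (1 : aquot) != 0.
Proof.
move=> fS; apply/eqP => e.
have f1 := aquot_liftE fS 1; have f0 := aquot_liftE fS 0.
move: f1; rewrite (rmorph1 aquot_pi) e -(raddf0 aquot_pi) f0 (rmorph1 f) (rmorph0 f).
by move/esym/eqP; rewrite oner_eq0.
Qed.

End AlgebraQuotient.

Section Bilinear.
Context (K : fieldType) (V W U : lmodType K).

Definition bilin (f : V -> W -> U) : Prop :=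
  (forall w, linear (f^~ w)) /\ (forall v, linear (f v)).

End Bilinear.

Section MalgLift.
Context (K : fieldType) (I : choiceType) (U : lmodType K) (f : I -> U).

Definition malg_lift (g : {malg K[I]}) : U := \sum_(i <- msupp g) g@_i *: f i.

Lemma malg_liftEw (d : {fset I}) (g : {malg K[I]}) : (msupp g `<=` d)%fset ->
  malg_lift g = \sum_(i <- d) g@_i *: f i.
Proof.
move=> le; rewrite [LHS](big_fset_incl _ le) => //= x xd /mcoeff_outdom ->.
by rewrite scale0r.
Qed.

Lemma malg_lift_linear : linear malg_lift.
Proof.
move=> a g h.
pose d := (msupp g `|` msupp h `|` msupp (a *: g + h))%fset.
rewrite !(@malg_liftEw d); last 3 first.
- by rewrite /d fsetUAC fsubsetUr.
- by rewrite /d -fsetUA fsubsetUl.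
- by rewrite /d fsubsetUr.
rewrite scaler_sumr -big_split /=; apply: eq_bigr => i _.
by rewrite mcoeffD mcoeffZ scalerDl scalerA.
Qed.

HB.instance Definition _ := GRing.isLinear.Build K {malg K[I]} U *:%R malg_lift
  malg_lift_linear.

Lemma malg_liftU i : malg_lift << i >> = f i.
Proof.
by rewrite (malg_liftEw (msuppU_le (k := i))) big_seq_fset1 mcoeffUU scale1r.
Qed.

End MalgLift.

Lemma malg_scaleU (K : fieldType) (I : choiceType) (a : K) (i : I) :
  << a *g i >> = a *: << i >>.
Proof. by apply/malgP => j; rewrite mcoeffZ !mcoeffU mulrnAr mulr1. Qed.

Section Tensor.
Context (K : fieldType) (V W : lmodType K).

Definition tensor_gens : set {malg K[(V * W)%type]} :=
  [set t | (exists a u v w,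
              t = << (a *: u + v, w) >> - a *: << (u, w) >> - << (v, w) >>)
        \/ (exists a v u w,
              t = << (v, a *: u + w) >> - a *: << (v, u) >> - << (v, w) >>)].

Definition tensor : Type := mquot tensor_gens.

HB.instance Definition _ := GRing.Lmodule.on tensor.

Definition tens (v : V) (w : W) : tensor := @mquot_pi K _ tensor_gens << (v, w) >>.

Lemma tens_bilin : bilin tens.
Proof.
split=> [w a u v|v a u w]; apply/eqP; rewrite -subr_eq0 /tens -linearZ /=.
  rewrite opprD addrA -!raddfB; apply/eqP/mquot_pi_gen; left.
  by exists a, u, v, w.
rewrite opprD addrA -!raddfB; apply/eqP/mquot_pi_gen; right.
by exists a, v, u, w.
Qed.

(* The linear map induced by a bilinear f; for other f the value depends on
   the choice of representatives and is meaningless *)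
Definition tlift (U : lmodType K) : (V -> W -> U) -> tensor -> U :=
  locked (fun f t => malg_lift (fun p => f p.1 p.2) (@mquot_repr K _ tensor_gens t)).

Lemma tliftE (U : lmodType K) (f : V -> W -> U) t :
  tlift f t = malg_lift (fun p => f p.1 p.2) (@mquot_repr K _ tensor_gens t).
Proof. by rewrite /tlift -lock. Qed.

Section LiftTheory.
Context (U : lmodType K) (f : V -> W -> U).
Hypothesis fbil : bilin f.

Lemma tlift_pi g :
  tlift f (@mquot_pi K _ tensor_gens g) = malg_lift (fun p => f p.1 p.2) g.
Proof.
apply/eqP; rewrite tliftE -subr_eq0 -raddfB; apply/eqP.
have [fl fr] := fbil.
apply: (@span_kill _ _ tensor_gens) => [||].
- exact: malg_lift_linear.
- move=> _ [[b [x [y [w ->]]]]|[b [w [x [y ->]]]]];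
    by rewrite !raddfB /= linearZ /= !malg_liftU /= ?fl ?fr -addrA -opprD subrr.
- by apply/mquot_piE; rewrite mquot_reprK.
Qed.

Lemma tlift_tens v w : tlift f (tens v w) = f v w.
Proof. by rewrite tlift_pi malg_liftU. Qed.

Lemma tlift_linear : linear (tlift f).
Proof.
move=> a; elim/mquot_ind => g; elim/mquot_ind => h.
have -> : a *: mquot_pi tensor_gens g + mquot_pi tensor_gens h
        = mquot_pi tensor_gens (a *: g + h) by rewrite linearP.
by rewrite !tlift_pi linearP.
Qed.

End LiftTheory.

End Tensor.

Arguments tlift {K V W U} f t.
Notation "x \ox y" := (tens x y) (at level 40, left associativity) : ring_scope.

(* In comulA the left-hand side is (Delta \ox id) o Delta followed by the
   identification (C \ox C) \ox C = C \ox (C \ox C) *)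
HB.mixin Record Lmodule_isCoalgebra (K : fieldType) C of GRing.Lmodule K C := {
  comul : C -> tensor C C;
  counit : C -> K;
  comul_linear : linear comul;
  counit_linear : scalar counit;
  comulA : forall c,
    tlift (fun c1 c2 => tlift (fun c11 c12 => c11 \ox (c12 \ox c2)) (comul c1))
      (comul c)
    = tlift (fun c1 c2 => c1 \ox comul c2) (comul c);
  counitl : forall c, tlift (fun c1 c2 => counit c1 *: c2) (comul c) = c;
  counitr : forall c, tlift (fun c1 c2 => counit c2 *: c1) (comul c) = c;
}.

#[short(type="coalgType")]
HB.structure Definition Coalgebra (K : fieldType) :=
  { C of Lmodule_isCoalgebra K C & GRing.Lmodule K C }.

(* Sweedler sum: [sweedler f h] is f(h_1, h_2) *)
Definition sweedler (K : fieldType) (C : coalgType K) (U : lmodType K)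
  (f : C -> C -> U) (h : C) : U := tlift f (comul h).

HB.mixin Record Coalgebra_isBialgebra (K : fieldType) H
    of GRing.Algebra K H & Coalgebra K H := {
  comulM : forall h k : H,
    comul (h * k) = sweedler (fun h1 h2 : H =>
      sweedler (fun k1 k2 : H => (h1 * k1) \ox (h2 * k2)) k) h;
  comul1 : comul (1 : H) = 1 \ox 1;
  counitM : {morph (counit : H -> K) : h k / h * k};
  counit1 : counit (1 : H) = 1;
}.

#[short(type="bialgType")]
HB.structure Definition Bialgebra (K : fieldType) :=
  { H of GRing.Algebra K H & Coalgebra K H & Coalgebra_isBialgebra K H }.

HB.mixin Record Bialgebra_isHopf (K : fieldType) H of Bialgebra K H := {
  antipode : H -> H;
  antipode_linear : linear antipode;
  antipodel : forall h : H,
    sweedler (fun h1 h2 : H => antipode h1 * h2) h = (counit h)%:A;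
  antipoder : forall h : H,
    sweedler (fun h1 h2 : H => h1 * antipode h2) h = (counit h)%:A;
}.

#[short(type="hopfType")]
HB.structure Definition Hopf (K : fieldType) :=
  { H of Bialgebra K H & Bialgebra_isHopf K H }.

Section Coalgebras.
Context (K : fieldType) (C : coalgType K).

Definition is_subspace (D : set C) : Prop :=
  D 0 /\ forall a x y, D x -> D y -> D (a *: x + y).

(* comul D lies in D \ox D, seen inside C \ox C *)
Definition is_subcoalgebra (D : set C) : Prop :=
  is_subspace D /\
  forall c, D c -> exists2 s : seq (C * C),
    (forall p, p \in s -> D p.1 /\ D p.2) & comul c = \sum_(p <- s) p.1 \ox p.2.

Definition is_simple_subcoalgebra (D : set C) : Prop :=
  [/\ is_subcoalgebra D, D <> [set 0] &
      forall E, is_subcoalgebra E -> E `<=` D -> E = [set 0] \/ E = D].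

Definition one_dimensional (D : set C) : Prop :=
  exists2 c, c != 0 & D = [set a *: c | a in [set: K]].

Definition pointed : Prop :=
  forall D, is_simple_subcoalgebra D -> one_dimensional D.

Definition grouplike (g : C) : Prop := g != 0 /\ comul g = g \ox g.

End Coalgebras.

Section FreeAlgebra.
Context (K : fieldType) (I : choiceType).

(* noncommutative polynomials: the monoid algebra of the free monoid on I *)
Definition free_alg : Type := {malg K[{fmonom I}]}.

HB.instance Definition _ := GRing.Lalgebra.on free_alg.

Lemma free_alg_scaleAr (a : K) (p q : free_alg) : a *: (p * q) = p * (a *: q).
Proof.
apply/malgP => k; rewrite mcoeffZ mcoeffMl.
rewrite (mcoeffMlw _ (fsubset_refl (msupp p)) (msuppZ_le a q)).
rewrite mulr_sumr; apply: eq_bigr => i _; rewrite mulr_sumr; apply: eq_bigr => j _.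
by rewrite mcoeffZ mulrnAr mulrCA.
Qed.

HB.instance Definition _ :=
  GRing.LSemiAlgebra_isSemiAlgebra.Build K free_alg free_alg_scaleAr.

Definition free_gen (i : I) : free_alg := << fmu i >>.

Section Lift.
Context (B : algType K) (f : I -> B).

Definition free_lift : free_alg -> B :=
  malg_lift (fun m : {fmonom I} => \prod_(i <- (m : seq I)) f i).

HB.instance Definition _ := GRing.Linear.on free_lift.

Lemma free_lift_monoid : monoid_morphism free_lift.
Proof.
split=> [|p q].
  rewrite /free_lift malg_liftU.
  by rewrite (_ : mone = FMonom [::] :> {fmonom I}) ?big_nil //; apply: fmoneE.
rewrite /free_lift malgME linear_sum.
rewrite [X in _ = X * _]/malg_lift mulr_suml; apply: eq_bigr => m _.
rewrite linear_sum [X in _ = _ * X]/malg_lift mulr_sumr; apply: eq_bigr => n _.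
rewrite malg_scaleU linearZ /= malg_liftU.
rewrite (_ : mmul m n = FMonom (m ++ n)) ?big_cat /=; last exact: fmmulE.
by rewrite -scalerAl -scalerAr scalerA.
Qed.

HB.instance Definition _ := GRing.isMonoidMorphism.Build free_alg B free_lift
  free_lift_monoid.

Lemma free_lift_gen i : free_lift (free_gen i) = f i.
Proof. by rewrite /free_lift malg_liftU fmuE big_seq1. Qed.

End Lift.
End FreeAlgebra.

Section TensorAlgebra.
Context (K : fieldType) (V : lmodType K).

Definition tensalg_gens : set (free_alg K V) :=
  [set x | exists a u v,
     x = free_gen K (a *: u + v) - (a *: free_gen K u + free_gen K v)].

(* T(V), as the algebra generated by the symbols v in V subject only to the
   relations saying that they depend linearly on v *)
Definition tensalg : Type := aquot tensalg_gens.

HB.instance Definition _ := GRing.Lmodule.on tensalg.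
HB.instance Definition _ := GRing.PzRing.on tensalg.

Section Lift.
Context (B : algType K) (f : V -> B).
Hypothesis f_lin : linear f.

Lemma tensalg_free_lift x : tensalg_gens x -> free_lift f x = 0.
Proof.
by move=> [a [u [v ->]]]; rewrite linearB linearP /= !free_lift_gen f_lin subrr.
Qed.

End Lift.

Lemma tensalg_oner_neq0 : (1 : tensalg) != 0.
Proof.
apply: (@aquot_nontrivial _ _ _ K^o (free_lift (fun _ : V => 0 : K^o))).
by apply: tensalg_free_lift => a u v; rewrite scaler0 addr0.
Qed.

HB.instance Definition _ := GRing.PzSemiRing_isNonZero.Build tensalg tensalg_oner_neq0.
HB.instance Definition _ :=
  GRing.LSemiModule_isLSemiAlgebra.Build K tensalg (@aquot_scaleAl _ _ tensalg_gens).
HB.instance Definition _ :=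
  GRing.LSemiAlgebra_isSemiAlgebra.Build K tensalg (@aquot_scaleAr _ _ tensalg_gens).

Definition tensalg_pi : free_alg K V -> tensalg := @aquot_pi _ _ tensalg_gens.

HB.instance Definition _ := GRing.LRMorphism.on tensalg_pi.

Definition tensalg_in : V -> tensalg := locked (fun v => tensalg_pi (free_gen K v)).

Lemma tensalg_in_linear : linear tensalg_in.
Proof.
rewrite /tensalg_in -lock => a u v; rewrite -linearP; apply/eqP; rewrite -subr_eq0 -raddfB.
by apply/eqP/aquot_pi_gen; exists a, u, v.
Qed.

HB.instance Definition _ := GRing.isLinear.Build K V tensalg *:%R tensalg_in
  tensalg_in_linear.

Section LiftMorphism.
Context (B : algType K) (f : {linear V -> B}).

Definition tensalg_lift : tensalg -> B := @aquot_lift _ _ tensalg_gens B (free_lift f).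

Lemma tensalg_lift_pi x : tensalg_lift (tensalg_pi x) = free_lift f x.
Proof.
by apply: (@aquot_liftE _ _ tensalg_gens B (free_lift f)); apply/tensalg_free_lift/linearP.
Qed.

Lemma tensalg_lift_linear : linear tensalg_lift.
Proof.
move=> a; elim/mquot_ind => x; elim/mquot_ind => y.
rewrite -/(tensalg_pi x) -/(tensalg_pi y).
have -> : a *: tensalg_pi x + tensalg_pi y = tensalg_pi (a *: x + y) by rewrite linearP.
by rewrite !tensalg_lift_pi linearP.
Qed.

Lemma tensalg_lift_monoid : monoid_morphism tensalg_lift.
Proof.
split=> [|]; first by rewrite -(rmorph1 tensalg_pi) tensalg_lift_pi rmorph1.
elim/mquot_ind => x; elim/mquot_ind => y.
rewrite -/(tensalg_pi x) -/(tensalg_pi y).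
have -> : tensalg_pi x * tensalg_pi y = tensalg_pi (x * y) by rewrite rmorphM.
by rewrite !tensalg_lift_pi rmorphM.
Qed.

HB.instance Definition _ := GRing.isLinear.Build K tensalg B *:%R tensalg_lift
  tensalg_lift_linear.
HB.instance Definition _ := GRing.isMonoidMorphism.Build tensalg B tensalg_lift
  tensalg_lift_monoid.

Lemma tensalg_lift_in v : tensalg_lift (tensalg_in v) = f v.
Proof. by rewrite /tensalg_in -lock tensalg_lift_pi free_lift_gen. Qed.

End LiftMorphism.
End TensorAlgebra.

Section SweedlerTheory.
Context (K : fieldType) (C : coalgType K).

Lemma sweedler_linear_eq (U U' : lmodType K) (f : U -> U')
    (b b' : C -> C -> U) c : linear f ->
  (forall x y, f (b x y) = f (b' x y)) -> f (sweedler b c - sweedler b' c) = 0.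
Proof.
move=> f_lin fb; pose F := GRing.isLinear.Build K U U' *:%R f f_lin.
pose g : {linear U -> U'} := HB.pack f F.
have fsw (d : C -> C -> U) : f (sweedler d c) = sweedler (fun x y => f (d x y)) c.
  rewrite /sweedler !tliftE /malg_lift; apply: etrans (linear_sum g _ _ _) _.
  by apply: eq_bigr => p _; apply: (linearZ_LR g).
apply: etrans (linearB g _ _) _; rewrite /= !fsw.
have -> : (fun x y => f (b x y)) = (fun x y => f (b' x y)).
  by apply/funext => x; apply/funext => y.
exact: subrr.
Qed.

Lemma sweedler_grouplike (U : lmodType K) (b : C -> C -> U) g :
  bilin b -> grouplike g -> sweedler b g = b g g.
Proof. by move=> bb [_ gg]; rewrite /sweedler gg tlift_tens. Qed.

Lemma counit_grouplike (g : C) : grouplike g -> counit g = 1.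
Proof.
move=> [g0 gg]; have := counitl g.
rewrite gg tlift_tens; last first.
  split=> [w a u v|v a u w]; rewrite ?counit_linear.
    by rewrite scalerDl scalerA.
  by rewrite scalerDr !scalerA mulrC.
move=> e; have /eqP : (counit g - 1) *: g = 0 by rewrite scalerBl e scale1r subrr.
by rewrite scaler_eq0 (negPf g0) orbF subr_eq0 => /eqP.
Qed.

End SweedlerTheory.

Section Hpar.
Context (K : fieldType) (H : hopfType K).

HB.instance Definition _ := GRing.isLinear.Build K H H *:%R (@antipode K H)
  antipode_linear.

(* For g grouplike, [antipode g] is the inverse of g in the group G(H) *)
Lemma grouplike_mulV (g : H) : grouplike g -> antipode g * g = 1 /\ g * antipode g = 1.
Proof.
move=> gl; split.
  have := antipodel g; rewrite sweedler_grouplike //.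
    by rewrite counit_grouplike // scale1r.
  by split=> [w a u v|v a u w]; rewrite ?linearP ?mulrDl ?mulrDr -?scalerAl -?scalerAr.
have := antipoder g; rewrite sweedler_grouplike //.
  by rewrite counit_grouplike // scale1r.
by split=> [w a u v|v a u w]; rewrite ?linearP ?mulrDl ?mulrDr -?scalerAl -?scalerAr.
Qed.

Local Notation T := (tensalg H).
Local Notation i := (@tensalg_in K H).

Inductive Hpar_gens : set T :=
| Hpar_unit : Hpar_gens (i 1 - 1)
| Hpar_left h k : Hpar_gens
    (sweedler (fun k1 k2 => i h * i k1 * i (antipode k2)) k
     - sweedler (fun k1 k2 => i (h * k1) * i (antipode k2)) k)
| Hpar_right h k : Hpar_gens
    (sweedler (fun h1 h2 => i h1 * i (antipode h2) * i k) h
     - sweedler (fun h1 h2 => i h1 * i (antipode h2 * k)) h).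

Definition Hpar : Type := aquot Hpar_gens.

HB.instance Definition _ := GRing.Lmodule.on Hpar.
HB.instance Definition _ := GRing.PzRing.on Hpar.

Lemma Hpar_gens_mul (f : T -> H) : linear f -> monoid_morphism f ->
  (forall h, f (i h) = h) -> forall x, Hpar_gens x -> f x = 0.
Proof.
move=> fl [f1 fM] fi.
have f2 a b : f (i a * i b) = a * b by rewrite fM !fi.
have f3 a b c : f (i a * i b * i c) = a * b * c by rewrite fM f2 fi.
move=> _ [|h k|h k].
- have := fl (-1) 1 (i 1); rewrite fi f1 !scaleN1r => e.
  by rewrite addrC; apply: (etrans e); rewrite addNr.
- by apply: (@sweedler_linear_eq K H T H f _ _ k fl) => x y;
    apply: (etrans (f3 h x (antipode y)) (esym (f2 (h * x) (antipode y)))).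
- by apply: (@sweedler_linear_eq K H T H f _ _ h fl) => x y;
    apply: (etrans (f3 x (antipode y) k)); rewrite -mulrA;
    apply: esym (f2 x (antipode y * k)).
Qed.

(* the multiplication T(H) -> H factors through Hpar *)
Lemma Hpar_oner_neq0 : (1 : Hpar) != 0.
Proof.
pose m : {linear H -> H} := idfun.
apply: (@aquot_nontrivial _ _ _ H (tensalg_lift m)); apply: Hpar_gens_mul.
- exact: tensalg_lift_linear.
- exact: tensalg_lift_monoid.
- exact: tensalg_lift_in.
Qed.

HB.instance Definition _ := GRing.PzSemiRing_isNonZero.Build Hpar Hpar_oner_neq0.
HB.instance Definition _ :=
  GRing.LSemiModule_isLSemiAlgebra.Build K Hpar (@aquot_scaleAl _ _ Hpar_gens).
HB.instance Definition _ :=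
  GRing.LSemiAlgebra_isSemiAlgebra.Build K Hpar (@aquot_scaleAr _ _ Hpar_gens).

Definition par : H -> Hpar := locked (fun h => aquot_pi Hpar_gens (i h)).

Lemma parE h : par h = aquot_pi Hpar_gens (i h).
Proof. by rewrite /par -lock. Qed.

Lemma par_linear : linear par.
Proof. by move=> a u v; rewrite !parE !linearP. Qed.

HB.instance Definition _ := GRing.isLinear.Build K H Hpar *:%R par par_linear.

Lemma par_sweedler (b : H -> H -> T) (k : H) :
  aquot_pi Hpar_gens (sweedler b k) = sweedler (fun x y => aquot_pi Hpar_gens (b x y)) k.
Proof.
rewrite /sweedler !tliftE /malg_lift.
apply: etrans (linear_sum (@aquot_pi _ _ Hpar_gens) _ _ _) _.
by apply: eq_bigr => p _; apply: aquot_piZ.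
Qed.

Lemma par_gensE (x y : T) : Hpar_gens (x - y) -> aquot_pi Hpar_gens x = aquot_pi Hpar_gens y.
Proof. by move=> /aquot_pi_gen; rewrite raddfB => /eqP; rewrite subr_eq0 => /eqP. Qed.

Lemma par1 : par 1 = 1.
Proof. by rewrite parE; exact: (par_gensE Hpar_unit). Qed.

Lemma par_left h k :
  sweedler (fun k1 k2 => par h * par k1 * par (antipode k2)) k
  = sweedler (fun k1 k2 => par (h * k1) * par (antipode k2)) k.
Proof.
have := par_gensE (Hpar_left h k); rewrite !par_sweedler => e.
transitivity (sweedler (fun k1 k2 =>
  aquot_pi Hpar_gens (i h * i k1 * i (antipode k2))) k).
  congr sweedler; apply/funext => x; apply/funext => y.
  by rewrite !aquot_piM !parE.
apply: (etrans e); congr sweedler; apply/funext => x; apply/funext => y.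
by rewrite aquot_piM !parE.
Qed.

Lemma par_right h k :
  sweedler (fun h1 h2 => par h1 * par (antipode h2) * par k) h
  = sweedler (fun h1 h2 => par h1 * par (antipode h2 * k)) h.
Proof.
have := par_gensE (Hpar_right h k); rewrite !par_sweedler => e.
transitivity (sweedler (fun h1 h2 =>
  aquot_pi Hpar_gens (i h1 * i (antipode h2) * i k)) h).
  congr sweedler; apply/funext => x; apply/funext => y.
  by rewrite !aquot_piM !parE.
apply: (etrans e); congr sweedler; apply/funext => x; apply/funext => y.
by rewrite aquot_piM !parE.
Qed.

Definition eps (h : H) : Hpar := sweedler (fun h1 h2 => par h1 * par (antipode h2)) h.

End Hpar.

Arguments par {K H} h.
Arguments eps {K H} h.

Section Algebras.
Context (K : fieldType) (B : algType K).

Inductive subalg_gen (S : set B) : set B :=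
| subalg_mem x of S x : subalg_gen S x
| subalg_one : subalg_gen S 1
| subalg_linear a x y of subalg_gen S x & subalg_gen S y : subalg_gen S (a *: x + y)
| subalg_mul x y of subalg_gen S x & subalg_gen S y : subalg_gen S (x * y).

(* D and E are subspaces closed under multiplication, regarded as algebras with
   units d and e, which need not be the unit of the ambient algebra *)
Definition alg_isom (C : algType K) (D : set B) (d : B) (E : set C) (e : C) : Prop :=
  exists f : B -> C,
    [/\ set_bij D E f,
        forall a x y, D x -> D y -> f (a *: x + y) = a *: f x + f y,
        forall x y, D x -> D y -> f (x * y) = f x * f y
      & f d = e].

End Algebras.

Section PartialAlgebra.
Context (K : fieldType) (H : hopfType K) (G : {fset H}).

Definition Apar : set (Hpar H) := subalg_gen (range eps).

(* The factors commute pairwise, so their order is irrelevant *)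
Definition projX (X : {fset H}) : Hpar H :=
  (\prod_(x <- X) eps x) * \prod_(y <- (G `\` X)%fset) (1 - eps y).

Definition AP (X : {fset H}) : set (Hpar H) := [set a * projX X | a in Apar].

Definition AP_isom (X Y : {fset H}) : Prop :=
  alg_isom (AP X) (projX X) (AP Y) (projX Y).

Definition in_P1 (X : {fset H}) : Prop := (X `<=` G)%fset /\ 1 \in X.

Definition translate (t : H) (X : {fset H}) : {fset H} := [fset t * x | x in X]%fset.

Definition stab (X : {fset H}) : {fset H} := [fset t in G | translate t X == X]%fset.

Definition conjugate (g : H) (Y : {fset H}) : {fset H} :=
  [fset g * t * antipode g | t in Y]%fset.

End PartialAlgebra.

(* Main.v *)
Require Import Defs.
From HB Require Import structures.
From mathcomp Require Import all_boot all_order all_algebra finmap.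
From mathcomp.multinomials Require Import monalg.
From mathcomp Require Import boolp classical_sets functions.

(** Let A be the subalgebra of Hpar generated by the eps h, let [h] denote par h, and
    let g be grouplike, so that its inverse is S g. Both isomorphisms come from
    conjugation by g, in two different senses.

    Conjugation inside Hpar. From the defining relations one gets
    [g] eps k = eps (g k) [g] ([par_eps]). Together with eps g = [g] [S g] this makes
    eps g a central idempotent of A ([Apar_comm], [eps_idem]), and it shows that
    left multiplication by [g] carries A to A and P_X to P_(gX) ([par_Apar],
    [par_projX]). The map a |-> [g] a [S g] hence sends A P_X to A P_(gX): the factor
    [g] [S g] = eps g that is left over is absorbed by P_(gX), as g = g 1 lies in gX.
    The map is multiplicative on A P_X and inverted by a |-> [S g] a [g] because
    [S g] [g] = eps (S g) is the identity on A P_X when g^-1 lies in X. This is (2),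
    proved in [AP_isom_translate].

    Conjugation of H. The stabiliser G_X need not contain g^-1, so the above does not
    apply to it; moreover it would yield a coset and not a conjugate. But
    h |-> g h g^-1 is an automorphism of the Hopf algebra H, and it
    therefore induces an automorphism of Hpar ([Hpar_inner]). It sends eps k to
    eps (g k g^-1), so it preserves A and maps P_Y to P_(gYg^-1) for every subset Y of
    G ([AP_isom_conjugate]). With Y = G_X this is the isomorphism in (1), and the
    equality in (1) holds because g G_X g^-1 is the stabiliser of gX
    ([conjugate_stab]).

    Both arguments need that the grouplike elements form a group and that
    S (g h) = S h g^-1 and S (h g) = g^-1 S h. The latter follow from the
    uniqueness of convolution inverses ([convolution_inverse_unique]). *)

Import GRing.Theory.

Local Open Scope fset_scope.
Local Open Scope classical_set_scope.
Local Open Scope ring_scope.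

(** * Linear maps on tensor products and Sweedler sums *)

Section TensorCalculus.
Context {K : fieldType}.

(** The value of [tlift] is a sum over a chosen representative of the tensor, for
    every [b], and a linear map commutes with that sum. *)
Lemma linear_tlift {V W U U' : lmodType K} {f : U -> U'} (b : V -> W -> U) t :
  linear f -> f (tlift b t) = tlift (fun v w => f (b v w)) t.
Proof.
move=> f_lin; pose F := GRing.isLinear.Build K U U' *:%R f f_lin.
pose g : {linear U -> U'} := HB.pack f F.
rewrite !tliftE /malg_lift; apply: etrans (linear_sum g _ _ _) _.
by apply: eq_bigr => p _; apply: (linearZ_LR g).
Qed.

Lemma eq_tlift {V W U : lmodType K} {b b' : V -> W -> U} t :
  (forall v w, b v w = b' v w) -> tlift b t = tlift b' t.
Proof. by move=> e; congr (tlift _ t); apply/funext => v; apply/funext => w. Qed.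

Lemma mul_bilin {V W : lmodType K} {B : algType K} (f : V -> B) (g : W -> B) :
  linear f -> linear g -> bilin (fun v w => f v * g w).
Proof.
move=> fl gl; split=> [w a u v|v a u w] /=.
  by rewrite fl mulrDl scalerAl.
by rewrite gl mulrDr scalerAr.
Qed.

Lemma mull_linear {B : algType K} (a : B) : linear (fun x : B => a * x).
Proof. by move=> c u v; rewrite mulrDr scalerAr. Qed.

Lemma mulr_linear {B : algType K} (a : B) : linear (fun x : B => x * a).
Proof. by move=> c u v; rewrite mulrDl scalerAl. Qed.

Lemma comp_bilin {V V' W W' U : lmodType K} (b : V -> W -> U)
    (l : V' -> V) (r : W' -> W) :
  bilin b -> linear l -> linear r -> bilin (fun x y => b (l x) (r y)).
Proof.
by case=> bl br ll rl; split=> [w a u v|v a u w] /=; rewrite ?ll ?rl ?bl ?br.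
Qed.

Lemma tlift_family_linear {X V W U : lmodType K} (f : X -> V -> W -> U) t :
  (forall v w, linear (fun x => f x v w)) -> linear (fun x => tlift (f x) t).
Proof.
move=> fl a x y; rewrite !tliftE /malg_lift scaler_sumr -big_split /=.
by apply: eq_bigr => p _; rewrite fl scalerDr !scalerA mulrC.
Qed.

Lemma tlift_tensE {V W : lmodType K} (t : tensor V W) : tlift (@tens K V W) t = t.
Proof.
elim/mquot_ind: t => t; rewrite tlift_pi; last exact: tens_bilin.
rewrite [in RHS](monalgE t) linear_sum; apply: eq_bigr => -[v w] _ /=.
by rewrite malg_scaleU linearZ.
Qed.

End TensorCalculus.

Section SweedlerCalculus.
Context {K : fieldType} {C : coalgType K}.

Lemma linear_sweedler {U U' : lmodType K} {f : U -> U'} (b : C -> C -> U) c :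
  linear f -> f (sweedler b c) = sweedler (fun x y => f (b x y)) c.
Proof. exact: linear_tlift. Qed.

Lemma eq_sweedler {U : lmodType K} {b b' : C -> C -> U} c :
  (forall x y, b x y = b' x y) -> sweedler b c = sweedler b' c.
Proof. exact: eq_tlift. Qed.

(** Coassociativity in the form in which it is used: the axiom [comulA] lives in
    C \ox (C \ox C), and a trilinear [f] is what can be evaluated there. *)
Lemma sweedlerA {U : lmodType K} (f : C -> C -> C -> U) c :
    (forall x, bilin (f x)) -> (forall y z, linear (fun x => f x y z)) ->
  sweedler (fun c1 c2 => sweedler (fun x y => f x y c2) c1) c =
  sweedler (fun c1 c2 => sweedler (f c1) c2) c.
Proof.
move=> f23 f1; pose F3 x := tlift (f x).
have F3bil : bilin F3.
  by split=> [t|x]; [apply: tlift_family_linear | apply: tlift_linear].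
have F3lin := tlift_linear F3bil.
have /(congr1 (tlift F3)) := comulA c.
rewrite !(linear_tlift _ _ F3lin) => e.
rewrite /sweedler; apply: etrans (etrans e _); apply: eq_tlift => x y.
  rewrite (linear_tlift _ _ F3lin); apply: eq_tlift => u v.
  by rewrite tlift_tens // /F3 tlift_tens.
by rewrite tlift_tens.
Qed.

(** In the convolution algebra of linear maps C -> B a left inverse f and a
    right inverse g of p agree, by f = f * (p * g) = (f * p) * g = g. Stating
    the uniqueness in this two-sided form gives the behaviour of the antipode
    under both left and right multiplication by grouplike elements. *)
Lemma convolution_inverse_unique {B : algType K} (f p g : {linear C -> B}) c :
    (forall x, sweedler (fun x1 x2 => f x1 * p x2) x = (counit x)%:A) ->
    (forall x, sweedler (fun x1 x2 => p x1 * g x2) x = (counit x)%:A) ->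
  f c = g c.
Proof.
move=> fp pg.
(* both sides become the triple convolution f * p * g, bracketed differently *)
transitivity (sweedler (fun c1 c2 =>
    f c1 * sweedler (fun x y => p x * g y) c2) c).
  rewrite -{1}[c]counitr (linear_tlift _ _ (linearP f)); apply: eq_tlift => x y.
  by rewrite pg -scalerAr mulr1 linearZ.
transitivity (sweedler (fun c1 c2 =>
    sweedler (fun x y => f x * p y) c1 * g c2) c); last first.
  rewrite -[in RHS](counitl c) (linear_tlift _ _ (linearP g)); apply: eq_tlift => x y.
  by rewrite fp -scalerAl mul1r linearZ.
transitivity (sweedler (fun c1 c2 =>
    sweedler (fun x y => f c1 * p x * g y) c2) c).
  apply: eq_sweedler => x y.
  rewrite (linear_sweedler (f := fun z => f x * z)); last first.
    by move=> a u v; rewrite mulrDr scalerAr.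
  by apply: eq_sweedler => u v; rewrite mulrA.
rewrite -(sweedlerA (fun x y z => f x * p y * g z)).
- apply: eq_sweedler => x y.
  rewrite (linear_sweedler (f := fun z => z * g y)) //.
  by move=> a u v; rewrite mulrDl scalerAl.
- move=> x; apply: (mul_bilin (fun y => f x * p y)) => [a u v|]; last exact: linearP.
  by rewrite linearP mulrDr scalerAr.
- by move=> y z a u v; rewrite linearP !mulrDl -!scalerAl.
Qed.

End SweedlerCalculus.

(** * Grouplike elements and the antipode *)

Section Grouplikes.
Context {K : fieldType} {H : hopfType K}.
Local Notation S := (@antipode K H).

(** As comul g = g \ox g, left multiplication by g acts on both legs of comul h;
    every computation with g h below goes through this lemma. *)
Lemma sweedler_mull {U : lmodType K} (b : H -> H -> U) {g h : H} :
    bilin b -> grouplike g ->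
  sweedler b (g * h) = sweedler (fun x y => b (g * x) (g * y)) h.
Proof.
move=> bb gg; rewrite {1}/sweedler comulM sweedler_grouplike //; last first.
  have tb x y := comp_bilin _ _ _ (tens_bilin H H) (mulr_linear x) (mulr_linear y).
  split=> w; apply: tlift_family_linear => x y; first exact: (tb x y).1.
  exact: (tb x y).2.
rewrite (linear_sweedler _ _ (tlift_linear bb)); apply: eq_sweedler => x y.
by rewrite tlift_tens.
Qed.

Lemma sweedler_mulr {U : lmodType K} (b : H -> H -> U) {g h : H} :
    bilin b -> grouplike g ->
  sweedler b (h * g) = sweedler (fun x y => b (x * g) (y * g)) h.
Proof.
move=> bb gg; rewrite {1}/sweedler comulM.
rewrite (linear_sweedler _ _ (tlift_linear bb)); apply: eq_sweedler => x y.
rewrite sweedler_grouplike ?tlift_tens //.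
exact: (comp_bilin _ _ _ (tens_bilin H H) (mull_linear x) (mull_linear y)).
Qed.

Lemma comul_sweedler (h : H) : comul h = sweedler (@tens K H H) h.
Proof. by rewrite /sweedler tlift_tensE. Qed.

Lemma grouplike1 : grouplike (1 : H).
Proof. by split; [exact: oner_neq0 | exact: comul1]. Qed.

Lemma grouplikeM {g h : H} : grouplike g -> grouplike h -> grouplike (g * h).
Proof.
move=> gg hh; have [Vg gV] := grouplike_mulV gg; split.
  apply: contra_neq hh.1 => e.
  by rewrite -[h]mul1r -Vg -mulrA e mulr0.
rewrite comul_sweedler sweedler_mull //; last exact: tens_bilin.
rewrite sweedler_grouplike //.
exact: comp_bilin (tens_bilin H H) (mull_linear g) (mull_linear g).
Qed.

(** In the algebra H \ox H, comul (S g) is the inverse of g \ox g. To avoid products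
    in H \ox H, the map x \ox y |-> S g x \ox S g y is applied to comul (g S g): it undoes the factor g \ox g, and it sends comul 1 = 1 \ox 1
    to S g \ox S g. *)
Lemma grouplikeV {g : H} : grouplike g -> grouplike (S g).
Proof.
move=> gg; have [Vg gV] := grouplike_mulV gg; split.
  apply: contra_neq (oner_neq0 H) => e; by rewrite -gV e mulr0.
have e : sweedler (fun x y => (S g * x) \ox (S g * y)) (g * S g) = comul (S g).
  rewrite sweedler_mull //; last first.
    exact: comp_bilin (tens_bilin H H) (mull_linear (S g)) (mull_linear (S g)).
  rewrite [RHS]comul_sweedler; apply: eq_sweedler => x y.
  by rewrite !mulrA Vg !mul1r.
rewrite -e gV (sweedler_grouplike _ grouplike1) ?mulr1 //.
exact: comp_bilin (tens_bilin H H) (mull_linear (S g)) (mull_linear (S g)).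
Qed.

Lemma grouplike_mulK {g : H} (h : H) : grouplike g -> S g * (g * h) = h.
Proof. by move=> gg; rewrite mulrA (grouplike_mulV gg).1 mul1r. Qed.

Lemma grouplike_mulVK {g : H} (h : H) : grouplike g -> g * (S g * h) = h.
Proof. by move=> gg; rewrite mulrA (grouplike_mulV gg).2 mul1r. Qed.

Lemma grouplike_antipodeK {g : H} : grouplike g -> S (S g) = g.
Proof.
move=> gg; have [Vg gV] := grouplike_mulV gg.
have [VVg _] := grouplike_mulV (grouplikeV gg).
by rewrite -[RHS]mul1r -VVg -mulrA Vg mulr1.
Qed.

Lemma counit_mull (g h : H) : grouplike g -> counit (g * h) = counit h.
Proof. by move=> gg; rewrite counitM counit_grouplike // mul1r. Qed.

Lemma counit_mulr (g h : H) : grouplike g -> counit (h * g) = counit h.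
Proof. by move=> gg; rewrite counitM (counit_grouplike gg) mulr1. Qed.

(** This is S (g h) = S h g^-1 with the inverse moved to the other side: the map
    x |-> S (g x) g is a left convolution inverse of the identity, hence it is S. *)
Lemma antipode_mull (g h : H) : grouplike g -> S (g * h) * g = S h.
Proof.
move=> gg; have f_lin : linear (fun x : H => S (g * x) * g).
  by move=> a x y; rewrite mulrDr -scalerAr linearP mulrDl scalerAl.
pose F := GRing.isLinear.Build K H H *:%R _ f_lin.
pose f : {linear H -> H} := HB.pack (fun x : H => S (g * x) * g) F.
apply: (convolution_inverse_unique f idfun S) => x; last exact: antipoder.
rewrite -(counit_mull g) // -antipodel sweedler_mull //.
  by apply: eq_sweedler => y z; rewrite /= mulrA.
apply: (mul_bilin S idfun) => //; exact: linearP.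
Qed.

Lemma antipode_mulr (g h : H) : grouplike g -> g * S (h * g) = S h.
Proof.
move=> gg; have f_lin : linear (fun x : H => g * S (x * g)).
  by move=> a x y; rewrite mulrDl -scalerAl linearP mulrDr scalerAr.
pose F := GRing.isLinear.Build K H H *:%R _ f_lin.
pose f : {linear H -> H} := HB.pack (fun x : H => g * S (x * g)) F.
apply: esym; apply: (convolution_inverse_unique S idfun f) => x.
  exact: antipodel.
rewrite -(counit_mulr g) // -antipoder sweedler_mulr //.
  by apply: eq_sweedler => y z; rewrite /= mulrA.
apply: (mul_bilin idfun S) => //; exact: linearP.
Qed.

End Grouplikes.

(** * The elements eps h of Hpar *)

Section PartialRepresentation.
Context {K : fieldType} {H : hopfType K}.
Local Notation S := (@antipode K H).

Lemma par_mul_bilin : bilin (fun x y : H => par x * par (S y)).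
Proof.
apply: (mul_bilin par (fun y => par (S y))) => [|a u v]; first exact: linearP.
by rewrite !linearP.
Qed.

Lemma eps_grouplike {g : H} : grouplike g -> eps g = par g * par (S g).
Proof. exact: sweedler_grouplike par_mul_bilin. Qed.

Lemma eps_grouplikeV {g : H} : grouplike g -> par (S g) * par g = eps (S g).
Proof. by move=> gg; rewrite (eps_grouplike (grouplikeV gg)) (grouplike_antipodeK gg). Qed.

Lemma eps1 : eps (1 : H) = 1.
Proof.
rewrite (eps_grouplike grouplike1).
have [_] := grouplike_mulV (@grouplike1 _ H).
by rewrite mul1r => ->; rewrite par1 mulr1.
Qed.

(** The commutation rule on which everything rests. The left relation of Hpar
    merges the first two factors of [g][k1][S k2]; the right relation merges the
    last two of [g k1][S (g k2)][g], where S (g k2) g = S k2. *)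
Lemma par_eps {g : H} (k : H) : grouplike g -> par g * eps k = eps (g * k) * par g.
Proof.
move=> gg; transitivity (sweedler (fun x y => par (g * x) * par (S y)) k).
  rewrite -par_left /eps (linear_sweedler _ _ (mull_linear (par g))).
  by apply: eq_sweedler => x y; rewrite mulrA.
rewrite /eps (linear_sweedler _ _ (mulr_linear (par g))) par_right.
rewrite sweedler_mull //.
  by apply: eq_sweedler => x y; rewrite antipode_mull.
apply: (mul_bilin par (fun y => par (S y * g))) => [|a u v]; first exact: linearP.
by rewrite linearP mulrDl -scalerAl linearP.
Qed.

Lemma eps_mul_par {g : H} : grouplike g -> eps g * par g = par g.
Proof. by move=> gg; rewrite -[g in eps g]mulr1 -par_eps // eps1 mulr1. Qed.

(** [g] [S g] shifts k by S g and then back by g, so it leaves eps k in place. *)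
Lemma eps_comm {g : H} (k : H) : grouplike g -> GRing.comm (eps g) (eps k).
Proof.
move=> gg; rewrite /GRing.comm (eps_grouplike gg) -mulrA par_eps; last exact: grouplikeV.
have [_ gV] := grouplike_mulV gg.
by rewrite mulrA par_eps // mulrA gV mul1r mulrA.
Qed.

Lemma eps_idem {g : H} : grouplike g -> eps g * eps g = eps g.
Proof. by move=> gg; rewrite {2}(eps_grouplike gg) mulrA eps_mul_par // -eps_grouplike. Qed.

Lemma Apar_comm {g : H} a : grouplike g -> Apar a -> GRing.comm (eps g) a.
Proof.
move=> gg; elim=> [_ [k _ <-]||c x y _ cx _ cy|x y _ cx _ cy].
- exact: eps_comm.
- exact: commr1.
- apply: commrD => //; rewrite /GRing.comm -scalerAl -scalerAr; congr (_ *: _); exact: cx.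
- exact: commrM.
Qed.

End PartialRepresentation.

(** * Products of commuting families *)

Section CommutingProducts.

(** The product in [projX] runs over the enumeration of a finite set, in an order that
    translation and conjugation do not preserve; commutation makes it irrelevant. *)
Lemma comm_perm_prod {R : pzRingType} {I : eqType} (F : I -> R) (s t : seq I) :
    {in s &, forall x y, GRing.comm (F x) (F y)} -> perm_eq s t ->
  \prod_(x <- s) F x = \prod_(x <- t) F x.
Proof.
elim: s t => [|x s IH] t cF; first by rewrite perm_sym => /perm_nilP ->.
move=> st; have xt : x \in t by rewrite -(perm_mem st) mem_head.
case/splitPr: xt st => t1 t2 st.
have e : perm_eq s (t1 ++ t2).
  by rewrite -(perm_cons x); apply: (perm_trans st); rewrite perm_catC /= perm_cons perm_catC.
rewrite big_cons (IH _ _ e); last first.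
  by move=> y z ys zs; apply: cF; rewrite inE ?ys ?zs orbT.
rewrite !big_cat big_cons /= !mulrA; congr (_ * _).
rewrite !big_seq; apply: commr_prod => y yt; apply: cF; first exact: mem_head.
by rewrite inE (perm_mem e) mem_cat yt orbT.
Qed.

Lemma prod_imfset {R : pzRingType} {I : choiceType} (F : I -> R) {u : I -> I}
    (X : {fset I}) :
    injective u -> {in X &, forall x y, GRing.comm (F (u x)) (F (u y))} ->
  \prod_(y <- [fset u x | x in X]%fset) F y = \prod_(x <- X) F (u x).
Proof.
move=> ui cF; rewrite -(big_map u xpredT F); apply: comm_perm_prod.
  by move=> _ _ /imfsetP[x xX ->] /imfsetP[y yX ->]; apply: cF.
by apply: enum_imfset => x y _ _; apply: ui.
Qed.

Lemma mulr_prod_intertwine {R : pzRingType} {I : eqType} (a : R) (F F' : I -> R)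
    (s : seq I) :
    {in s, forall x, a * F x = F' x * a} ->
  a * (\prod_(x <- s) F x) = (\prod_(x <- s) F' x) * a.
Proof.
elim: s => [|x s IH] aF; first by rewrite !big_nil mulr1 mul1r.
rewrite !big_cons mulrA aF ?mem_head // -mulrA IH ?mulrA // => y ys.
by apply: aF; rewrite inE ys orbT.
Qed.

(** Needed for the second product in [projX], which runs over the complement of X
    in G. *)
Lemma imfset_can_setD {I : choiceType} {u v : I -> I} (A X : {fset I}) :
    cancel u v -> cancel v u -> (forall x, (u x \in A) = (x \in A)) ->
  (A `\` [fset u x | x in X])%fset = [fset u x | x in A `\` X]%fset.
Proof.
move=> uK vK uA; apply/fsetP => y; rewrite -[y]vK !inE uA.
by rewrite !(mem_imfset _ _ (can_inj uK)) /= inE.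
Qed.

End CommutingProducts.

(** * Isomorphisms from mutually inverse maps *)

Section AlgebraIsomorphisms.
Context {K : fieldType}.

Lemma alg_isom_inverse {B C : algType K} {D : set B} {d : B} {E : set C} {e : C}
    (f : B -> C) (f' : C -> B) :
    linear f -> (forall x, D x -> E (f x)) -> (forall y, E y -> D (f' y)) ->
    (forall x, D x -> f' (f x) = x) -> (forall y, E y -> f (f' y) = y) ->
    (forall x y, D x -> D y -> f (x * y) = f x * f y) -> f d = e ->
  alg_isom D d E e.
Proof.
move=> fl fE f'D fK f'K fM fd; exists f; split=> // [|a x y _ _]; last exact: fl.
split=> //.
  by move=> x y /set_mem Dx /set_mem Dy exy; rewrite -(fK x) // -(fK y) // exy.
by move=> y Ey; exists (f' y); [exact: f'D | exact: f'K].
Qed.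

End AlgebraIsomorphisms.

(** * The idempotents projX X *)

Section Idempotents.
Context {K : fieldType} {H : hopfType K} (G : {fset H}).
Hypothesis G_grouplike : forall g : H, g \in G -> grouplike g.
Local Notation S := (@antipode K H).

Lemma one_sub_eps_comm {g k : H} : grouplike g -> grouplike k ->
  GRing.comm (1 - eps g) (1 - eps k).
Proof.
move=> gg gk; apply: commrB; first exact: commr1.
by apply: commr_sym; apply: commrB; [exact: commr1 | exact: eps_comm].
Qed.

(** Applied to both symmetries of G that occur, x |-> g x and x |-> g x g^-1. *)
Lemma projX_imfset {u v : H -> H} {X : {fset H}} :
    cancel u v -> cancel v u -> (forall x, (u x \in G) = (x \in G)) ->
    (X `<=` G)%fset ->
  projX G [fset u x | x in X]%fset =
  (\prod_(x <- X) eps (u x)) * (\prod_(y <- (G `\` X)%fset) (1 - eps (u y))).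
Proof.
move=> uK vK uG /fsubsetP XG; rewrite /projX (imfset_can_setD _ _ uK vK uG).
have ui := can_inj uK.
have ugl x : x \in G -> grouplike (u x) by rewrite -uG; apply: G_grouplike.
rewrite !prod_imfset //.
  move=> x y; rewrite !inE => /andP[_ xG] /andP[_ yG].
  by apply: one_sub_eps_comm; apply: ugl.
by move=> x y xX yX; apply: eps_comm; apply/ugl/XG.
Qed.

Lemma eps_projX {g : H} {X : {fset H}} : (X `<=` G)%fset -> g \in X ->
  eps g * projX G X = projX G X.
Proof.
move=> /fsubsetP XG gX; have gg : grouplike g by apply/G_grouplike/XG.
rewrite /projX mulrA; congr (_ * _).
rewrite (@comm_perm_prod _ _ _ _ _ _ (perm_to_rem gX)); last first.
  by move=> x y xX yX; apply/eps_comm/G_grouplike/XG.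
by rewrite big_cons mulrA eps_idem.
Qed.

Lemma Apar_eps (k : H) : Apar (eps k).
Proof. by apply: subalg_mem; exists k. Qed.

Lemma AparB {a b : Hpar H} : Apar a -> Apar b -> Apar (a - b).
Proof. by move=> Aa Ab; rewrite addrC -scaleN1r; apply: subalg_linear. Qed.

Lemma Apar_prod {I : Type} (s : seq I) (F : I -> Hpar H) :
  (forall i, Apar (F i)) -> Apar (\prod_(i <- s) F i).
Proof.
by move=> AF; elim/big_ind: _ => // [|x y]; [exact: subalg_one | exact: subalg_mul].
Qed.

Lemma Apar_projX (X : {fset H}) : Apar (projX G X).
Proof.
apply: subalg_mul; apply: Apar_prod => x; first exact: Apar_eps.
by apply: AparB; [exact: subalg_one | exact: Apar_eps].
Qed.

Lemma AP_Apar {X : {fset H}} {a : Hpar H} : AP G X a -> Apar a.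
Proof. by case=> b Ab <-; exact: subalg_mul Ab (Apar_projX X). Qed.

Lemma AP_eps {g : H} {X : {fset H}} {a : Hpar H} : (X `<=` G)%fset -> g \in X ->
  AP G X a -> eps g * a = a.
Proof.
move=> XG gX [b Ab <-]; have gg := G_grouplike _ (fsubsetP XG _ gX).
by rewrite mulrA (Apar_comm _ gg Ab) -mulrA eps_projX.
Qed.

Lemma AP_eps_r {g : H} {X : {fset H}} {a : Hpar H} : (X `<=` G)%fset -> g \in X ->
  AP G X a -> a * eps g = a.
Proof.
move=> XG gX APa; have gg := G_grouplike _ (fsubsetP XG _ gX).
by rewrite -[LHS](Apar_comm a gg (AP_Apar APa)) (AP_eps XG gX).
Qed.

End Idempotents.

(** * Conjugation by [par g] and translates of X *)

Section Translation.
Context {K : fieldType} {H : hopfType K} {G : {fset H}}.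
Hypothesis G_grouplike : forall g : H, g \in G <-> grouplike g.
Local Notation S := (@antipode K H).

Lemma grouplike_mem_mull {g : H} (h : H) : grouplike g -> (g * h \in G) = (h \in G).
Proof.
move=> gg; apply/idP/idP => /G_grouplike hG; apply/G_grouplike; last exact: grouplikeM gg hG.
by rewrite -(grouplike_mulK h gg); exact: grouplikeM (grouplikeV gg) hG.
Qed.

Lemma grouplike_mem_mulr {g : H} (h : H) : grouplike g -> (h * g \in G) = (h \in G).
Proof.
move=> gg; apply/idP/idP => /G_grouplike hG; apply/G_grouplike; last exact: grouplikeM hG gg.
by rewrite -[h]mulr1 -(grouplike_mulV gg).2 mulrA; exact: grouplikeM hG (grouplikeV gg).
Qed.

Lemma mem_translate {g : H} (X : {fset H}) (h : H) : grouplike g ->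
  (h \in translate g X) = (S g * h \in X).
Proof.
move=> gg; rewrite -{1}(grouplike_mulVK h gg) mem_imfset //.
by move=> x y e; rewrite -(grouplike_mulK x gg) e grouplike_mulK.
Qed.

Lemma translate_sub {g : H} {X : {fset H}} : grouplike g -> (X `<=` G)%fset ->
  (translate g X `<=` G)%fset.
Proof.
move=> gg /fsubsetP XG; apply/fsubsetP => h; rewrite (mem_translate _ _ gg) => /XG.
by rewrite (grouplike_mem_mull _ (grouplikeV gg)).
Qed.

Lemma translateM {g h : H} (X : {fset H}) : grouplike g -> grouplike h ->
  translate g (translate h X) = translate (g * h) X.
Proof.
move=> gg gh; apply/fsetP => x; have ggh := grouplikeM gg gh.
rewrite (mem_translate _ _ gg) (mem_translate _ _ gh) (mem_translate _ _ ggh); congr (_ \in X).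
by rewrite -{1}(grouplike_mulVK x ggh) -(mulrA g h) !grouplike_mulK.
Qed.

Lemma translate1 (X : {fset H}) : translate 1 X = X.
Proof.
apply/fsetP => x; rewrite mem_translate; last exact: grouplike1.
by rewrite -{1}[x]mul1r grouplike_mulK //; exact: grouplike1.
Qed.

Lemma translateK {g : H} (X : {fset H}) : grouplike g ->
  translate (S g) (translate g X) = X.
Proof.
move=> gg; by rewrite (translateM _ (grouplikeV gg) gg) (grouplike_mulV gg).1 translate1.
Qed.

(** The indices of both products in [projX] are moved by [par_eps]. *)
Lemma par_projX {g : H} {X : {fset H}} : grouplike g -> (X `<=` G)%fset ->
  par g * projX G X = projX G (translate g X) * par g.
Proof.
move=> gg XG.
rewrite (@projX_imfset _ _ _ _ ( *%R g) ( *%R (S g))) => [|h /G_grouplike //|h|h|h|//].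
- rewrite /projX mulrA (mulr_prod_intertwine (par g) eps (fun x => eps (g * x))); last first.
    by move=> x _; apply: par_eps.
  rewrite -[LHS]mulrA (mulr_prod_intertwine (par g) (fun y => 1 - eps y)
    (fun y => 1 - eps (g * y))) ?mulrA //.
  by move=> y _; rewrite mulrBr mulrBl mulr1 mul1r par_eps.
- exact: grouplike_mulK.
- exact: grouplike_mulVK.
- exact: grouplike_mem_mull.
Qed.

(** By [par_eps] the factor [g] passes through the generators, hence through A. *)
Lemma par_Apar {g : H} {a : Hpar H} : grouplike g -> Apar a ->
  exists2 b, Apar b & par g * a = b * par g.
Proof.
move=> gg; elim=> {a} [_ [k _ <-]||c x y _ [x' Ax' ex] _ [y' Ay' ey]
                      |x y _ [x' Ax' ex] _ [y' Ay' ey]].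
- by exists (eps (g * k)); [exact: Apar_eps | exact: par_eps].
- by exists 1; [exact: subalg_one | rewrite mulr1 mul1r].
- exists (c *: x' + y'); first exact: subalg_linear.
  by rewrite mulrDr mulrDl -scalerAr -scalerAl ex ey.
- exists (x' * y'); first exact: subalg_mul.
  by rewrite mulrA ex -mulrA ey mulrA.
Qed.

(** On Hpar this map is not multiplicative, since the inner factors
    [S g] [g] = eps (S g) need not be 1; it is on AP X when S g lies in X. *)
Definition par_conj (g : H) (a : Hpar H) : Hpar H := par g * a * par (S g).

(** What remains after moving [g] past the idempotent is the factor
    [g] [S g] = eps g, absorbed because 1 \in X puts g in the translate of X. *)
Lemma par_conj_projX {g : H} {X : {fset H}} : grouplike g -> in_P1 G X ->
  par_conj g (projX G X) = projX G (translate g X).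
Proof.
move=> gg [XG X1]; rewrite /par_conj par_projX // -[LHS]mulrA -(eps_grouplike gg).
have gG (h : H) : h \in G -> grouplike h by move=> /G_grouplike.
rewrite -[LHS](Apar_comm _ gg (Apar_projX G _)) eps_projX //.
  exact: translate_sub.
by rewrite mem_translate // (grouplike_mulV gg).1.
Qed.

Lemma AP_par_conj {g : H} {X : {fset H}} {a : Hpar H} : grouplike g ->
    in_P1 G X -> AP G X a -> AP G (translate g X) (par_conj g a).
Proof.
move=> gg X1 [b Ab <-]; have [b' Ab' eb] := par_Apar gg Ab.
exists b' => //; rewrite -par_conj_projX // /par_conj.
by rewrite [in RHS](mulrA (par g) b) eb -!mulrA.
Qed.

Lemma par_conjK {g : H} {X : {fset H}} {a : Hpar H} : grouplike g ->
    in_P1 G X -> S g \in X -> AP G X a -> par_conj (S g) (par_conj g a) = a.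
Proof.
move=> gg [XG X1] gX Aa; have gG (h : H) : h \in G -> grouplike h by move=> /G_grouplike.
have e := eps_grouplikeV gg.
rewrite /par_conj grouplike_antipodeK // !mulrA e -mulrA e.
by rewrite (AP_eps _ gG XG gX Aa) (AP_eps_r _ gG XG gX Aa).
Qed.

(** The situation is symmetric: S g lies in X because of the hypothesis, and
    S (S g) = g lies in the translate of X because 1 lies in X. The inverse is thus
    the map of the same form for S g. *)
Lemma AP_isom_translate (g : H) (X : {fset H}) : grouplike g -> in_P1 G X ->
  S g \in X -> AP_isom G X (translate g X).
Proof.
move=> gg X1 gX; have gVg := grouplikeV gg.
have gG (h : H) : h \in G -> grouplike h by move=> /G_grouplike.
have P1g : in_P1 G (translate g X).
  by split; [apply: translate_sub gg X1.1 | rewrite mem_translate // mulr1].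
have gg' : S (S g) \in translate g X.
  by rewrite grouplike_antipodeK // mem_translate // (grouplike_mulV gg).1 X1.2.
have e := eps_grouplikeV gg.
apply: (alg_isom_inverse (par_conj g) (par_conj (S g))).
- by move=> c x y; rewrite /par_conj mulrDr mulrDl -scalerAr -scalerAl.
- by move=> x; apply: AP_par_conj.
- by move=> y /(AP_par_conj gVg P1g); rewrite translateK.
- by move=> x; apply: par_conjK.
- by move=> y /(par_conjK gVg P1g gg'); rewrite grouplike_antipodeK.
- move=> x y Ax Ay; rewrite /par_conj -!mulrA; congr (_ * _).
  by rewrite (mulrA (par (S g)) (par g)) e mulrA -(AP_eps_r _ gG X1.1 gX Ax) -!mulrA
    (mulrA (eps _) (eps _)) eps_idem.
- exact: par_conj_projX.
Qed.

End Translation.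

(** * The automorphism of Hpar induced by an inner automorphism of H *)

Section InnerAutomorphism.
Context {K : fieldType} {H : hopfType K}.
Local Notation S := (@antipode K H).

Definition inner (g h : H) : H := g * h * S g.

Lemma inner_linear (g : H) : linear (inner g).
Proof. by move=> a x y; rewrite /inner mulrDr mulrDl -scalerAr -scalerAl. Qed.

HB.instance Definition _ (g : H) :=
  GRing.isLinear.Build K H H *:%R (inner g) (inner_linear g).

Lemma innerM {g : H} (h k : H) : grouplike g -> inner g (h * k) = inner g h * inner g k.
Proof. by move=> gg; rewrite /inner -!mulrA (grouplike_mulK _ gg). Qed.

Lemma inner1 {g : H} : grouplike g -> inner g 1 = 1.
Proof. by move=> gg; rewrite /inner mulr1 (grouplike_mulV gg).2. Qed.

Lemma innerK {g : H} (h : H) : grouplike g -> inner (S g) (inner g h) = h.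
Proof.
move=> gg; rewrite /inner (grouplike_antipodeK gg) -!mulrA (grouplike_mulV gg).1.
by rewrite mulr1 (grouplike_mulK _ gg).
Qed.

Lemma innerVK {g : H} (h : H) : grouplike g -> inner g (inner (S g) h) = h.
Proof.
by move=> gg; rewrite -{1}(grouplike_antipodeK gg); apply: innerK; exact: grouplikeV.
Qed.

(** The two one-sided rules for the antipode combine to
    S (g h g^-1) = g (S h) g^-1, so that [inner g] is a morphism of Hopf algebras. *)
Lemma inner_antipode {g : H} (h : H) : grouplike g -> inner g (S h) = S (inner g h).
Proof.
move=> gg; rewrite /inner -(antipode_mull g h gg) -mulrA -(mulrA _ g).
rewrite (grouplike_mulV gg).2 mulr1 -(antipode_mulr (S g) (g * h) (grouplikeV gg)).
by rewrite (grouplike_mulVK _ gg).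
Qed.

Lemma sweedler_inner {U : lmodType K} (b : H -> H -> U) {g h : H} :
    bilin b -> grouplike g ->
  sweedler b (inner g h) = sweedler (fun x y => b (inner g x) (inner g y)) h.
Proof.
move=> bb gg; rewrite (sweedler_mulr _ bb (grouplikeV gg)) (sweedler_mull _ _ gg) //.
exact: comp_bilin bb (mulr_linear (S g)) (mulr_linear (S g)).
Qed.

(** The relations of Hpar only involve the product, the coproduct and the
    antipode, all of which [inner g] preserves: the image of the relation at (h, k)
    is the relation at (inner g h, inner g k). *)
Lemma inner_Hpar_gens {g : H} : grouplike g ->
  forall x, Hpar_gens x -> tensalg_lift (par \o inner g : {linear H -> Hpar H}) x = 0.
Proof.
move=> gg; set L := tensalg_lift _.
have Li h : L (tensalg_in h) = par (inner g h) := tensalg_lift_in _ h.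
have Llin : linear L := linearP _.
have LB x y : L (x - y) = L x - L y := linearB _ x y.
have [L1 LM] : monoid_morphism L := tensalg_lift_monoid _.
move=> _ [|h k|h k]; rewrite LB.
- by rewrite Li L1 inner1 // par1 subrr.
- rewrite !(linear_sweedler _ _ Llin); apply/eqP; rewrite subr_eq0; apply/eqP.
  transitivity (sweedler (fun x y => par (inner g h) * par x * par (S y)) (inner g k)).
    rewrite sweedler_inner //; last first.
      apply: (mul_bilin (fun x => par (inner g h) * par x) (fun y => par (S y))).
        by move=> a u v; rewrite linearP mulrDr scalerAr.
      by move=> a u v; rewrite !linearP.
    by apply: eq_sweedler => x y; rewrite !LM !Li inner_antipode.
  rewrite par_left sweedler_inner //; last first.
    apply: (mul_bilin (fun x => par (inner g h * x)) (fun y => par (S y))).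
      by move=> a u v; rewrite mulrDr -scalerAr linearP.
    by move=> a u v; rewrite !linearP.
  by apply: eq_sweedler => x y; rewrite !LM !Li inner_antipode // innerM.
- rewrite !(linear_sweedler _ _ Llin); apply/eqP; rewrite subr_eq0; apply/eqP.
  transitivity (sweedler (fun x y => par x * par (S y) * par (inner g k)) (inner g h)).
    rewrite sweedler_inner //; last first.
      split=> [w a u v|v a u w]; first by rewrite linearP !mulrDl -!scalerAl.
      by rewrite (linearP S) linearP mulrDr mulrDl -scalerAr -scalerAl.
    by apply: eq_sweedler => x y; rewrite !LM !Li inner_antipode.
  rewrite par_right sweedler_inner //; last first.
    apply: (mul_bilin par (fun y => par (S y * inner g k))); first exact: linearP.
    by move=> a u v; rewrite linearP mulrDl -scalerAl linearP.
  by apply: eq_sweedler => x y; rewrite !LM !Li innerM // inner_antipode.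
Qed.

(** The lock keeps unification from unfolding the lift through the quotients. *)
Definition Hpar_inner (g : H) : Hpar H -> Hpar H :=
  locked (@aquot_lift _ _ (@Hpar_gens K H) _
    (tensalg_lift (par \o inner g : {linear H -> Hpar H}))).

Section Grouplike.
Context {g : H}.
Hypothesis gg : grouplike g.

Lemma Hpar_inner_pi x : Hpar_inner g (aquot_pi (@Hpar_gens K H) x) =
  tensalg_lift (par \o inner g : {linear H -> Hpar H}) x.
Proof. by rewrite /Hpar_inner -lock (aquot_liftE (inner_Hpar_gens gg)). Qed.

Lemma Hpar_inner_linear : linear (Hpar_inner g).
Proof.
move=> a; elim/mquot_ind => x; elim/mquot_ind => y.
rewrite -/(aquot_pi (@Hpar_gens K H) x) -/(aquot_pi (@Hpar_gens K H) y).
rewrite -aquot_piZ -[X in Hpar_inner g X](raddfD (aquot_pi (@Hpar_gens K H))).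
by rewrite !Hpar_inner_pi; exact: tensalg_lift_linear.
Qed.

Lemma Hpar_inner_monoid : monoid_morphism (Hpar_inner g).
Proof.
split.
  by apply: (etrans (Hpar_inner_pi 1)); rewrite rmorph1.
elim/mquot_ind => x; elim/mquot_ind => y.
rewrite -/(aquot_pi (@Hpar_gens K H) x) -/(aquot_pi (@Hpar_gens K H) y).
have -> : aquot_pi (@Hpar_gens K H) x * aquot_pi (@Hpar_gens K H) y =
          aquot_pi (@Hpar_gens K H) (x * y) := esym (aquot_piM _ x y).
by rewrite !Hpar_inner_pi; exact: (tensalg_lift_monoid _).2.
Qed.

Lemma Hpar_inner_par h : Hpar_inner g (par h) = par (inner g h).
Proof. by rewrite [in LHS]parE Hpar_inner_pi tensalg_lift_in. Qed.

Lemma Hpar_inner_eps h : Hpar_inner g (eps h) = eps (inner g h).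
Proof.
rewrite /eps (linear_sweedler _ _ Hpar_inner_linear).
rewrite sweedler_inner //; last exact: par_mul_bilin.
apply: eq_sweedler => x y.
by rewrite Hpar_inner_monoid.2 !Hpar_inner_par inner_antipode.
Qed.

Lemma Hpar_inner_Apar a : Apar a -> Apar (Hpar_inner g a).
Proof.
have [f1 fM] := Hpar_inner_monoid.
elim=> {a} [_ [k _ <-]||c x y _ Ax _ Ay|x y _ Ax _ Ay].
- by rewrite Hpar_inner_eps; exact: Apar_eps.
- by rewrite f1; exact: subalg_one.
- by rewrite (Hpar_inner_linear c x y); exact: subalg_linear Ax Ay.
- by rewrite fM; exact: subalg_mul Ax Ay.
Qed.

End Grouplike.

Lemma Hpar_innerK {g : H} a : grouplike g -> Apar a ->
  Hpar_inner (S g) (Hpar_inner g a) = a.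
Proof.
move=> gg; have gVg := grouplikeV gg.
have [f1 fM] := Hpar_inner_monoid gg; have [f'1 f'M] := Hpar_inner_monoid gVg.
elim=> {a} [_ [k _ <-]||c x y _ ex _ ey|x y _ ex _ ey].
- by rewrite !Hpar_inner_eps // innerK.
- by rewrite f1.
- by rewrite (Hpar_inner_linear gg c x y) (Hpar_inner_linear gVg) ex ey.
- by rewrite (fM x y) f'M ex ey.
Qed.

End InnerAutomorphism.

(** * Conjugates of X *)

Section Conjugation.
Context {K : fieldType} {H : hopfType K} {G : {fset H}}.
Hypothesis G_grouplike : forall g : H, g \in G <-> grouplike g.
Local Notation S := (@antipode K H).

Lemma grouplike_mem_inner {g : H} (h : H) : grouplike g -> (inner g h \in G) = (h \in G).
Proof.
move=> gg; rewrite (grouplike_mem_mulr G_grouplike _ (grouplikeV gg)).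
exact: grouplike_mem_mull.
Qed.

Lemma mem_conjugate {g : H} (Y : {fset H}) (h : H) : grouplike g ->
  (h \in conjugate g Y) = (inner (S g) h \in Y).
Proof.
move=> gg; rewrite -{1}(innerVK h gg) mem_imfset //.
exact: can_inj (fun x => innerK x gg).
Qed.

Lemma conjugateK {g : H} (Y : {fset H}) : grouplike g ->
  conjugate (S g) (conjugate g Y) = Y.
Proof.
move=> gg; apply/fsetP => h; rewrite (mem_conjugate _ _ (grouplikeV gg)).
by rewrite (mem_conjugate _ _ gg) (grouplike_antipodeK gg) (innerK _ gg).
Qed.

Lemma conjugate_sub {g : H} {Y : {fset H}} : grouplike g -> (Y `<=` G)%fset ->
  (conjugate g Y `<=` G)%fset.
Proof.
move=> gg /fsubsetP YG; apply/fsubsetP => h; rewrite (mem_conjugate _ _ gg) => /YG.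
by rewrite (grouplike_mem_inner _ (grouplikeV gg)).
Qed.

Lemma Hpar_inner_projX {g : H} {Y : {fset H}} : grouplike g -> (Y `<=` G)%fset ->
  Hpar_inner g (projX G Y) = projX G (conjugate g Y).
Proof.
move=> gg YG; have [f1 fM] := Hpar_inner_monoid gg.
have gG (h : H) : h \in G -> grouplike h by move=> /G_grouplike.
have fprod s (F F' : H -> Hpar H) : (forall x, Hpar_inner g (F x) = F' x) ->
    Hpar_inner g (\prod_(x <- s) F x) = \prod_(x <- s) F' x.
  move=> FF'; elim: s => [|x s IH]; first by rewrite !big_nil.
  by rewrite !big_cons fM IH FF'.
rewrite (projX_imfset _ gG (fun x => innerK x gg) (fun x => innerVK x gg) _ YG).
  rewrite fM; congr (_ * _); apply: fprod => x; first exact: Hpar_inner_eps.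
  rewrite addrC -scaleN1r (Hpar_inner_linear gg) (Hpar_inner_eps gg) f1.
  by rewrite scaleN1r addrC.
by move=> x; exact: grouplike_mem_inner.
Qed.

Lemma AP_Hpar_inner {g : H} {Y : {fset H}} {a : Hpar H} : grouplike g ->
  (Y `<=` G)%fset -> AP G Y a -> AP G (conjugate g Y) (Hpar_inner g a).
Proof.
move=> gg YG [b Ab <-]; exists (Hpar_inner g b); first exact: Hpar_inner_Apar.
by rewrite -Hpar_inner_projX // (Hpar_inner_monoid gg).2.
Qed.

(** The isomorphism is the restriction of an automorphism of A that permutes the
    idempotents. *)
Lemma AP_isom_conjugate {g : H} {Y : {fset H}} : grouplike g -> (Y `<=` G)%fset ->
  AP_isom G Y (conjugate g Y).
Proof.
move=> gg YG; have gVg := grouplikeV gg.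
apply: (alg_isom_inverse (Hpar_inner g) (Hpar_inner (S g))).
- exact: Hpar_inner_linear.
- by move=> x; exact: AP_Hpar_inner.
- by move=> y /(AP_Hpar_inner gVg (conjugate_sub gg YG)); rewrite conjugateK.
- by move=> x /AP_Apar; exact: Hpar_innerK.
- by move=> y /AP_Apar Ay; rewrite -{1}(grouplike_antipodeK gg) Hpar_innerK.
- by move=> x y _ _; exact: (Hpar_inner_monoid gg).2.
- exact: Hpar_inner_projX.
Qed.

Lemma mem_stab (X : {fset H}) (t : H) : (t \in stab G X) = (t \in G) && (translate t X == X).
Proof. by rewrite !inE. Qed.

(** (g^-1 t g) X = X holds exactly when t (g X) = g X. *)
Lemma conjugate_stab {g : H} (X : {fset H}) : grouplike g ->
  conjugate g (stab G X) = stab G (translate g X).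
Proof.
move=> gg; have gVg := grouplikeV gg; apply/fsetP => t.
rewrite (mem_conjugate _ _ gg) !mem_stab (grouplike_mem_inner _ gVg).
have [/G_grouplike tt /=|//] := boolP (t \in G).
rewrite /inner (grouplike_antipodeK gg).
rewrite -(translateM _ (grouplikeM gVg tt) gg) -(translateM _ gVg tt).
apply/eqP/eqP => [e|->]; last exact: translateK.
by rewrite -[LHS](translateK _ gVg) e (grouplike_antipodeK gg).
Qed.

End Conjugation.

Theorem corollary2p20 (K : fieldType) (H : hopfType K) (G : {fset H})
    (H_pointed : pointed H)
    (antipode_bij : bijective (antipode : H -> H))
    (G_grouplike : forall g : H, g \in G <-> grouplike g)
    (X : {fset H}) (X_P1 : in_P1 G X)
    (g : H) (gG : g \in G) (gVX : antipode g \in X) :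
  (AP_isom G (stab G X) (conjugate g (stab G X)) /\
   AP G (conjugate g (stab G X)) = AP G (stab G (translate g X))) /\
  AP_isom G X (translate g X).
Proof.
have gg : grouplike g by apply/G_grouplike.
split; last exact: AP_isom_translate.
split; last by rewrite conjugate_stab.
apply: AP_isom_conjugate => //.
by apply/fsubsetP => t; rewrite mem_stab => /andP[].
Qed.
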